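(* Consider the lost-sales inventory model with caps $\lambda_t\in[0,\bar D]$, carry-safe caps $a_t=\min_{s=t,\ldots,T}\lambda_s$ and $q_t=p_t/(h_t+p_t)$. Suppose the conditional noninformative-censoring assumption (see context) holds, $x_1\in[0,a_1]$, and $F_t^-(a_t)>q_t$ for every $t\in[T]$. Define $W_t=\min\{D_t,a_t\}$ and $\kappa_t=\sum_{s=t}^Tp_s\mathbb E[D_s-W_s]$. Write $V_{t,D}^\pi$ and $V_{t,W}^\pi$ for the lost-sales policy values of $\pi$ under the original demands $(D_s)$ and the truncated demands $(W_s)$, respectively, and use a superscript $*$ for the corresponding optimal values. For every $t\in[T]$, every $x\in[0,a_t]$, and every policy $\pi$ whose actions remain within the caps (its period-$s$ post-order level is at most $a_s$ for every $s$), $$V_{t,D}^\pi(x)=V_{t,W}^\pi(x)+\kappa_t,\qquad V_{t,D}^\pi(x)-V_{t,D}^*(x)=V_{t,W}^\pi(x)-V_{t,W}^*(x).$$ The two systems have identical sales and inventory trajectories when coupled with the same demands and policy randomization.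
   Context: Lost-sales inventory model. Horizon $T$; $[n]=\{1,\ldots,n\}$, $u^+=\max\{u,0\}$. Demands $D_1,\ldots,D_T$ are independent with laws $P_t$ supported on $[0,\bar D]$, $\bar D>0$; $F_t^-(u)=\mathbb P(D_t<u)$. Holding and shortage coefficients $h_t,p_t>0$ are known; fixed and per-unit ordering costs, lead time, and terminal salvage value are zero. Starting period $t$ with inventory $x_t\ge0$, the retailer chooses a post-order level $y_t\ge x_t$ before demand and incurs $c_t(y_t,D_t)$ with $c_t(y,d)=h_t(y-d)^++p_t(d-y)^+$. The next state is $(y_t-D_t)^+$; only sales $\min\{D_t,y_t\}$ are observed. A feasible policy chooses each action using the information then available (in particular the sales history) and may randomize. The value of a policy from period $t$ and state $x$ is its expected total cost over periods $t,\ldots,T$; the optimal value is the infimum over all feasible policies. The truncated system is the same model with $D_t$ replaced by $W_t$. Sales logs and caps. Offline data are logs $((Z_t^j,b_t^j):t\in[T],j\in[N_t])$ with known boundary $b_t^j\ge0$ and $Z_t^j=\min\{D_t^j,b_t^j\}$, where $D_t^j$ is a latent fitting demand. Conditional noninformative censoring: conditional on the complete boundary array $\mathcal B=(b_t^j)$, all latent $D_t^j$ are mutually independent and $D_t^j$ has law $P_t$; each boundary is fixed or determined before its own demand. The numbers $\lambda_t$ are chosen before observing fitting demands, or using only $\mathcal B$; an independent pilot is also allowed if, conditional on the pilot, design information, and complete boundaries, fitting demands remain independent with laws $P_t$. *)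

(* Defs.v *)
From HB Require Import structures.
From mathcomp Require Import all_boot all_order all_algebra.
From mathcomp Require Import all_classical all_reals all_analysis.
Import Order.TTheory GRing.Theory Num.Theory.

Set Implicit Arguments.
Unset Strict Implicit.
Unset Printing Implicit Defensive.

Local Open Scope classical_set_scope.
Local Open Scope ring_scope.

Definition pos_part (R : realType) (u : R) : R := Num.max u 0.

(* Periods are the natural numbers 1, ..., horizon; the values of the
   nat-indexed data outside that range are junk and never used. *)
Record lost_sales_model (R : realType) := LostSalesModel {
  horizon : nat;
  Dbar : R;
  law : nat -> probability (measurableTypeR R) R;
  hold : nat -> R;
  short : nat -> R;
  horizon_gt0 : (0 < horizon)%N;
  Dbar_gt0 : 0 < Dbar;
  law_support : forall t, (1 <= t <= horizon)%N ->
    law t `[0, Dbar]%classic = 1%E;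
  hold_gt0 : forall t, (1 <= t <= horizon)%N -> 0 < hold t;
  short_gt0 : forall t, (1 <= t <= horizon)%N -> 0 < short t
}.

Definition period (R : realType) (M : lost_sales_model R) (t : nat) : Prop :=
  (1 <= t <= horizon M)%N.

Definition period_cost (R : realType) (M : lost_sales_model R) (t : nat)
    (y d : R) : R :=
  hold M t * pos_part (y - d) + short M t * pos_part (d - y).

Definition critical_ratio (R : realType) (M : lost_sales_model R) (t : nat) : R :=
  short M t / (hold M t + short M t).

(* F_t^-(u) = P(D_t < u) *)
Definition left_cdf (R : realType) (M : lost_sales_model R) (t : nat) (u : R) :
    \bar R :=
  law M t `]-oo, u[%classic.

(* Taking A t = setT for the periods left out gives the product rule over every
   subfamily. *)
Record demand_process (R : realType) (M : lost_sales_model R)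
    (d : measure_display) (Omega : measurableType d) (P : probability Omega R)
    (D : nat -> {RV P >-> R}) : Prop := DemandProcess {
  demand_law : forall t, period M t ->
    forall A : set R, measurable A -> P (D t @^-1` A) = law M t A;
  demand_independent : forall A : nat -> set R,
    (forall t, measurable (A t)) ->
    P [set w | forall t, period M t -> A t (D t w)] =
      (\prod_(1 <= t < (horizon M).+1) P (D t @^-1` A t))%E
}.

(* In period s, after k periods have been observed, the order-up-to level is
   act s k u x z, where x is the current inventory, z lists the k sales observed
   since the starting period (most recent first) and u is the private random
   seed, drawn from seed_law independently of the demands.  Whatever was
   recorded before the starting period is a fixed parameter of the policy. *)
Record policy (R : realType) := Policy {
  seed_display : measure_display;
  seed : measurableType seed_display;
  seed_law : probability seed R;
  act : nat -> forall k : nat, seed -> R -> k.-tuple R -> R;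
  act_measurable : forall s k,
    measurable_fun [set: seed * R * k.-tuple R]
      (fun v => act s v.1.1 v.1.2 v.2);
  act_ge : forall s k (u : seed) (x : R) (z : k.-tuple R),
    0 <= x -> x <= act s u x z
}.

Section Trajectories.
Variables (R : realType) (pi : policy R) (t : nat) (x : R).
Variables (u : seed pi) (dem : nat -> R).

(* Pre-order inventory and recorded sales, k periods after a start in period t
   with inventory x. *)
Fixpoint run (k : nat) : R * k.-tuple R :=
  match k with
  | 0 => (x, [tuple])
  | k'.+1 =>
      let: (xk, z) := run k' in
      let y := act (k' + t)%N u xk z in
      let d := dem (k' + t)%N in
      (pos_part (y - d), [tuple of Num.min d y :: z])
  end.

Definition inventory (s : nat) : R := (run (s - t)).1.

Definition level (s : nat) : R := act s u (run (s - t)).1 (run (s - t)).2.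

Definition sales (s : nat) : R := Num.min (dem s) (level s).

Definition total_cost (M : lost_sales_model R) : R :=
  \sum_(t <= s < (horizon M).+1) period_cost M s (level s) (dem s).

Definition levels_within (M : lost_sales_model R) (a : nat -> R) : Prop :=
  forall s, (t <= s <= horizon M)%N -> level s <= a s.

End Trajectories.

Section Values.
Variables (R : realType) (M : lost_sales_model R).
Variables (d : measure_display) (Omega : measurableType d).
Variable P : probability Omega R.
Variables (dem : nat -> Omega -> R) (t : nat) (x : R).

Definition policy_value (pi : policy R) : \bar R :=
  (\int[P \x seed_law pi]_w
     (total_cost t x w.2 (dem ^~ w.1) M)%:E)%E.

Definition optimal_value : \bar R :=
  ereal_inf [set v | exists pi : policy R, v = policy_value pi].

Definition stays_within (pi : policy R) (a : nat -> R) : Prop :=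
  {ae (P \x seed_law pi)%E, forall w, levels_within t x w.2 (dem ^~ w.1) M a}.

End Values.

(* min_{s = t..T} lambda_s, for t <= T *)
Definition carry_safe (R : realType) (M : lost_sales_model R)
    (lambda : nat -> R) (t : nat) : R :=
  \big[Num.min/lambda t]_(t <= s < (horizon M).+1) lambda s.

Definition truncate (R : realType) (Omega : Type) (a : nat -> R)
    (D : nat -> Omega -> R) : nat -> Omega -> R :=
  fun t w => Num.min (D t w) (a t).

Definition shortage_offset (R : realType) (M : lost_sales_model R)
    (d : measure_display) (Omega : measurableType d) (P : probability Omega R)
    (D W : nat -> Omega -> R) (t : nat) : \bar R :=
  (\sum_(t <= s < (horizon M).+1)
     (short M s)%:E * 'E_P[(fun w => D s w - W s w)%R])%E.

(* Offline logs: in period t there are log_size t entries, indexed from 0.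
   [pilot] carries all design information other than the boundaries (the
   independent pilot in particular); a constant is the case of none. *)
Record sales_logs (R : realType) (d : measure_display)
    (Omega : measurableType d) (Q : probability Omega R) := SalesLogs {
  log_size : nat -> nat;
  fitting_demand : nat -> nat -> {RV Q >-> R};
  boundary : nat -> nat -> {RV Q >-> R};
  pilot_display : measure_display;
  pilot_type : measurableType pilot_display;
  pilot : Omega -> pilot_type;
  pilot_measurable : measurable_fun setT pilot
}.

Definition logged_entry (R : realType) (M : lost_sales_model R)
    (d : measure_display) (Omega : measurableType d) (Q : probability Omega R)
    (L : sales_logs Q) (t j : nat) : Prop :=
  period M t /\ (j < log_size L t)%N.

(* Z_t^j, the only part of a fitting demand that the log shows. *)
Definition logged_sale (R : realType) (d : measure_display)
    (Omega : measurableType d) (Q : probability Omega R) (L : sales_logs Q)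
    (t j : nat) : Omega -> R :=
  fun w => Num.min (fitting_demand L t j w) (boundary L t j w).

(* The sigma-algebra generated by the pilot and the complete boundary array. *)
Definition design_events (R : realType) (M : lost_sales_model R)
    (d : measure_display) (Omega : measurableType d) (Q : probability Omega R)
    (L : sales_logs Q) : set (set Omega) :=
  <<s [set C | (exists2 A, measurable A & C = pilot L @^-1` A) \/
       (exists t j (A : set R), [/\ logged_entry M L t j, measurable A &
          C = boundary L t j @^-1` A])] >>.

(* Given the design events the fitting demands are independent with the
   deterministic laws P_t.  As the conditional probability is the constant
   \prod P_t(A_tj), its defining identity over each design event C is the product
   formula below.  It makes every boundary independent of its own demand, which
   is all that "fixed or determined before its own demand" contributes. *)
Record noninformative_censoring (R : realType) (M : lost_sales_model R)
    (d : measure_display) (Omega : measurableType d) (Q : probability Omega R)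
    (L : sales_logs Q) : Prop := NoninformativeCensoring {
  boundary_ge0 : forall t j, logged_entry M L t j ->
    forall w, 0 <= boundary L t j w;
  conditional_independence :
    forall (C : set Omega) (A : nat -> nat -> set R),
    design_events M L C -> (forall t j, measurable (A t j)) ->
    Q (C `&` [set w | forall t j, logged_entry M L t j ->
                        A t j (fitting_demand L t j w)]) =
      (Q C * \prod_(1 <= t < (horizon M).+1)
               \prod_(j < log_size L t) law M t (A t j))%E
}.

Record admissible_caps (R : realType) (M : lost_sales_model R)
    (d : measure_display) (Omega : measurableType d) (Q : probability Omega R)
    (L : sales_logs Q) (lambda : nat -> Omega -> R) : Prop := AdmissibleCaps {
  caps_range : forall t, period M t ->
    forall w, 0 <= lambda t w <= Dbar M;
  caps_design : forall t, period M t ->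
    forall A : set R, measurable A -> design_events M L (lambda t @^-1` A)
}.

(* Main.v *)
(* For a policy that stays within the caps the two systems share one trajectory:
   at a level y <= a_s, min(D_s, a_s) and D_s give the same sales and the same
   leftover stock, and the costs differ by p_s (D_s - W_s), which does not depend
   on the policy.  For the optimal values it then suffices that in either system
   some optimal policy stays within the caps.  Since P(D_s < a_s) > q_s, the
   expected one-period cost increases beyond a_s; the value functions of the
   dynamic program are convex and nondecreasing, so the expected cost-to-go has a
   minimiser S_s in [0, a_s], and the base-stock policy with levels S_s is
   optimal.  It stays within the caps because a_s is nondecreasing in s.
   Optimality against history-dependent randomised policies uses that, for a
   fixed seed, the level of a period is a function of the earlier demands, hence
   independent of the current one. *)

Require Import Defs.
From mathcomp Require Import all_boot all_order all_algebra.
From mathcomp Require Import all_classical all_reals all_analysis.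
From mathcomp Require Import measurable_realfun ring lra.
Import Order.TTheory GRing.Theory Num.Theory.
Import numFieldNormedType.Exports.

Set Implicit Arguments.
Unset Strict Implicit.
Unset Printing Implicit Defensive.

Local Open Scope classical_set_scope.
Local Open Scope ring_scope.

(** * Integration against independent variables *)

Lemma integral_independent_pair (R : realType) (d : measure_display)
    (Omega : measurableType d) (P : probability Omega R) (Y X : Omega -> R)
    (f : R * R -> \bar R) :
  measurable_fun setT Y -> measurable_fun setT X ->
  measurable_fun [set: R * R] f -> (forall v, 0 <= f v)%E ->
  (forall A B, measurable A -> measurable B ->
     P (Y @^-1` A `&` X @^-1` B) = (P (Y @^-1` A) * P (X @^-1` B))%E) ->
  (\int[P]_w f (Y w, X w) = \int[P]_w \int[P]_w' f (Y w, X w'))%E.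
Proof.
move=> mY mX mf f0 indep.
have mYX : measurable_fun setT (fun w => (Y w, X w)).
  exact: measurable_fun_pair.
pose PY := distribution P (mfun_Sub (mem_set mY) : {RV P >-> R}).
pose PX := distribution P (mfun_Sub (mem_set mX) : {RV P >-> R}).
(* A product measure is determined by its rectangles, so the factorisation hypothesis makes the
   joint law of [(Y, X)] the product of the marginals. Change of variables and Tonelli do the
   rest. *)
have joint (S : set (R * R)) : measurable S ->
    (PY \x PX)%E S = pushforward P (fun w => (Y w, X w)) S.
  by move=> mS; exact: (product_measure_unique (m1 := PY) (m2 := PX)
    (m' := pushforward P (fun w => (Y w, X w)))).
have -> : (\int[P]_w f (Y w, X w))%E = (\int[PY \x PX]_z f z)%E.
  rewrite (eq_measure_integral (pushforward P (fun w => (Y w, X w)))); last first.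
    by move=> S mS _; exact: joint.
  rewrite ge0_integral_pushforward//.
rewrite fubini_tonelli1//.
rewrite ge0_integral_pushforward//=.
- apply: eq_integral => w _.
  rewrite /fubini_F ge0_integral_pushforward//=.
  exact: measurableT_comp.
- exact: measurable_fun_fubini_tonelli_F.
- by move=> y _; exact: integral_ge0.
Qed.

(* A component is dropped from the product rule by taking [A s = setT]. *)
Definition independent_upto (R : realType) (d : measure_display)
    (Omega : measurableType d) (P : probability Omega R)
    (n : nat) (X : nat -> Omega -> R) : Prop :=
  forall A : nat -> set R, (forall t, measurable (A t)) ->
    P [set w | forall t, (1 <= t <= n)%N -> A t (X t w)] =
      (\prod_(1 <= t < n.+1) P (X t @^-1` A t))%E.

(** A pi-system generating the information carried by all components except the [s]-th; closure
    under intersection is what permits the extension from rectangles to the whole sigma-algebra. *)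
Definition other_rectangles (R : realType) (Omega : Type) (n : nat)
    (X : nat -> Omega -> R) (s : nat) : set (set Omega) :=
  [set C | exists2 A : nat -> set R, (forall t, measurable (A t)) &
     C = [set w | forall t, (1 <= t <= n)%N -> t != s -> A t (X t w)]].

Section Independence.
Context {R : realType} {d : measure_display} {Omega : measurableType d}.
Variables (P : probability Omega R) (n : nat) (X : nat -> Omega -> R).
Hypothesis mX : forall t, measurable_fun setT (X t).
Hypothesis indX : independent_upto P n X.
Variables (s : nat) (hs : (1 <= s <= n)%N).

Lemma measurable_other_rectangles : other_rectangles n X s `<=` measurable.
Proof.
move=> _ [A mA ->].
rewrite [X in measurable X](_ : _ = \bigcap_(t in [set t | (1 <= t <= n)%N /\ t != s])
    (X t @^-1` A t)); last first.
  by apply/seteqP; split => w /= + t => [H []|H *]; apply: H.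
apply: bigcap_measurableType => t _.
by rewrite -[_ @^-1` _]setTI; exact: mX.
Qed.

Lemma setI_closed_other_rectangles : setI_closed (other_rectangles n X s).
Proof.
move=> _ _ [A mA ->] [B mB ->]; exists (fun t => A t `&` B t).
  by move=> t; exact: measurableI.
apply/seteqP; split => w /= => [[HA HB] t ht ts|H].
  by split; [exact: HA|exact: HB].
by split => t ht ts; have [] := H t ht ts.
Qed.

Lemma independent_upto_rectangle (C : set Omega) (B : set R) :
  other_rectangles n X s C -> measurable B ->
  P (C `&` X s @^-1` B) = (P C * P (X s @^-1` B))%E.
Proof.
move=> [A mA ->] mB.
(* Used twice: with [E = B], and with [E = setT] to recognise the product over [t != s] as the
   probability of [C]. *)
have prodE (E : set R) : measurable E ->
    P ([set w | forall t, (1 <= t <= n)%N -> t != s -> A t (X t w)] `&`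
       X s @^-1` E) =
    (P (X s @^-1` E) * \prod_(t <- index_iota 1 n.+1 | t != s) P (X t @^-1` A t))%E.
  move=> mE; pose A' t := if t == s then E else A t.
  have mA' t : measurable (A' t) by rewrite /A'; case: ifP.
  rewrite [X in P X](_ : _ = [set w | forall t, (1 <= t <= n)%N -> A' t (X t w)]).
    rewrite indX// (bigD1_seq s)/= ?iota_uniq ?mem_index_iota ?ltnS//.
    rewrite /A' eqxx; congr (_ * _)%E.
    by apply: eq_bigr => t /negbTE ->.
  apply/seteqP; split => w /=.
    by move=> [HA HE] t ht; rewrite /A'; case: eqP => [->//|/eqP ts]; exact: HA.
  move=> H; split => [t ht ts|].
    by have := H t ht; rewrite /A' (negbTE ts).
  by have := H s hs; rewrite /A' eqxx.
rewrite prodE// muleC; congr (_ * _)%E.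
by have := prodE setT measurableT; rewrite preimage_setT setIT probability_setT mul1e.
Qed.

(** For fixed [B], both sides are finite measures in [C]. They agree on the pi-system of rectangles,
    hence on the sigma-algebra it generates. *)
Lemma independent_of_others (C : set Omega) (B : set R) :
  <<s other_rectangles n X s >> C -> measurable B ->
  P (C `&` X s @^-1` B) = (P C * P (X s @^-1` B))%E.
Proof.
move=> sC mB.
have mXB : measurable (X s @^-1` B) by rewrite -[_ @^-1` _]setTI; exact: mX.
have pE : (0 <= fine (P (X s @^-1` B)))%R by exact: fine_ge0.
rewrite muleC -[X in (X * _)%E]fineK ?fin_num_measure//.
apply: (g_sigma_algebra_measure_unique (other_rectangles n X s)
  measurable_other_rectangles (fun=> setT) _ _
  (mrestr P mXB) (mscale (NngNum pE) P) setI_closed_other_rectangles) => //.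
- move=> _; exists (fun=> setT) => //.
  by apply/seteqP; split.
- by rewrite bigcup_const.
- move=> E hE; rewrite [LHS](independent_upto_rectangle hE mB) muleC.
  transitivity ((fine (P (X s @^-1` B)))%:E * P E)%E => [|//].
  by rewrite fineK ?fin_num_measure.
- move=> _; change (P (setT `&` X s @^-1` B) < +oo)%E; rewrite setTI.
  by rewrite (le_lt_trans (probability_le1 _ _))// ltry.
Qed.

Lemma measurable_other_component (t : nat) (B : set R) :
  (1 <= t <= n)%N -> t != s -> measurable B ->
  <<s other_rectangles n X s >> (X t @^-1` B).
Proof.
move=> ht ts mB; apply: sub_sigma_algebra.
exists (fun r => if r == t then B else setT).
  by move=> r; case: ifP.
apply/seteqP; split => w /= => [Bw r hr rs|/(_ t ht ts)]; last by rewrite eqxx.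
by case: eqP => // ->.
Qed.

End Independence.

(** * Measurability of trajectories and costs *)

Section Measurability.
Context {R : realType}.

Lemma measurable_pos_part d (T : measurableType d) (f : T -> R) :
  measurable_fun setT f -> measurable_fun setT (fun w => pos_part (f w)).
Proof. by move=> mf; exact: measurable_maxr. Qed.

Lemma measurable_period_cost (M : lost_sales_model R) s d (T : measurableType d)
    (f g : T -> R) :
  measurable_fun setT f -> measurable_fun setT g ->
  measurable_fun setT (fun w => period_cost M s (f w) (g w)).
Proof.
move=> mf mg; apply: measurable_funD; apply: measurable_funM => //.
  by apply: measurable_pos_part; exact: measurable_funB.
by apply: measurable_pos_part; exact: measurable_funB.
Qed.

Lemma runS (pi : policy R) t x (u : seed pi) (dem : nat -> R) k :
  let r := run t x u dem k in
  let y := act (k + t)%N u r.1 r.2 in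
  run t x u dem k.+1 =
    (pos_part (y - dem (k + t)%N), [tuple of Num.min (dem (k + t)%N) y :: r.2]).
Proof. by rewrite /=; case: (run t x u dem k). Qed.

Lemma level_run (pi : policy R) t x (u : seed pi) (dem : nat -> R) k :
  level t x u dem (k + t) =
  act (k + t)%N u (run t x u dem k).1 (run t x u dem k).2.
Proof. by rewrite /level addnK. Qed.

Variables (pi : policy R) (t : nat) (x : R).
Context {d : measure_display} {T : measurableType d}.
Variables (U : T -> seed pi) (dem : nat -> T -> R).
Hypothesis mU : measurable_fun setT U.

Lemma measurable_act s k (f : T -> R) (g : T -> k.-tuple R) :
  measurable_fun setT f -> measurable_fun setT g ->
  measurable_fun setT (fun w => act s (U w) (f w) (g w)).
Proof.
move=> mf mg.
apply: (@measurableT_comp _ _ _ _ _ _ _ _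
  (fun w => ((U w, f w), g w)) (@act_measurable _ pi s k)).
by apply: measurable_fun_pair => //; exact: measurable_fun_pair.
Qed.

(** Nonanticipation is recorded by asking measurability of the first [k] demands only. As [T] and
    [U] are arbitrary, this applies to the product space with [U = snd] and also to [Omega] under a
    smaller sigma-algebra with a constant seed. *)
Lemma measurable_run k :
  (forall i, (i < k)%N -> measurable_fun setT (dem (i + t)%N)) ->
  measurable_fun setT (fun w => (run t x (U w) (dem ^~ w) k).1) /\
  measurable_fun setT (fun w => (run t x (U w) (dem ^~ w) k).2).
Proof.
elim: k => [|k IH] mdem; first by split => /=; exact: measurable_cst.
have [] := IH; first by move=> i ik; apply: mdem; rewrite ltnW.
move=> m1 m2.
have mk := mdem k (ltnSn k).
have my := measurable_act (k + t) m1 m2.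
split.
- have := measurable_pos_part (measurable_funB my mk).
  by apply: eq_measurable_fun => w _; rewrite runS.
- have := measurable_cons (measurable_minr mk my) m2.
  by apply: eq_measurable_fun => w _; rewrite runS.
Qed.

Lemma measurable_level k :
  (forall i, (i < k)%N -> measurable_fun setT (dem (i + t)%N)) ->
  measurable_fun setT (fun w => level t x (U w) (dem ^~ w) (k + t)).
Proof.
move=> /measurable_run [m1 m2]; have := measurable_act (k + t) m1 m2.
by apply: eq_measurable_fun => w _; rewrite level_run.
Qed.

(** Periods are counted from the start [t], as in [run], so that induction on [k] splits off the
    latest period. *)
Definition cost_upto (pi : policy R) (M : lost_sales_model R) t x (u : seed pi)
    (dem : nat -> R) (k : nat) : R :=
  \sum_(0 <= i < k) period_cost M (i + t) (level t x u dem (i + t)) (dem (i + t)%N).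

Lemma measurable_cost_upto (M : lost_sales_model R) k :
  (forall i, (i < k)%N -> measurable_fun setT (dem (i + t)%N)) ->
  measurable_fun setT (fun w => cost_upto M t x (U w) (dem ^~ w) k).
Proof.
elim: k => [|k IH] mdem.
  have : measurable_fun [set: T] (cst (0 : R)) by exact: measurable_cst.
  by apply: eq_measurable_fun => w _; rewrite /cost_upto big_geq.
have mk : measurable_fun setT (fun w => period_cost M (k + t)
    (level t x (U w) (dem ^~ w) (k + t)) (dem (k + t)%N w)).
  apply: measurable_period_cost; last exact: mdem.
  by apply: measurable_level => i ik; apply: mdem; rewrite ltnW.
have mc : measurable_fun setT (fun w => cost_upto M t x (U w) (dem ^~ w) k).
  by apply: IH => i ik; apply: mdem; rewrite ltnW.
have := measurable_funD mc mk; by apply: eq_measurable_fun => w _; rewrite /cost_upto big_nat_recr.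
Qed.

End Measurability.

Lemma total_cost_upto (R : realType) (pi : policy R) (M : lost_sales_model R) t x
    (u : seed pi) (dem : nat -> R) :
  total_cost t x u dem M = cost_upto M t x u dem ((horizon M).+1 - t).
Proof. by rewrite /total_cost /cost_upto -{1}[t]add0n big_addn. Qed.

(** * Averaging over the demand of the current period *)

Section PeriodStep.
Context {R : realType} {d : measure_display} {Omega : measurableType d}.
Variables (P : probability Omega R) (n : nat) (X : nat -> Omega -> R).
Hypothesis mX : forall t, measurable_fun setT (X t).
Hypothesis indX : independent_upto P n X.
Variables (pi : policy R) (t : nat) (x : R) (k : nat).
Hypotheses (t_gt0 : (0 < t)%N) (ktn : (k + t <= n)%N).
Variable f : R * R -> \bar R.
Hypotheses (mf : measurable_fun [set: R * R] f) (f0 : forall v, (0 <= f v)%E).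

Lemma level_independent (u : seed pi) (A B : set R) :
  measurable A -> measurable B ->
  let Y := fun w => level t x u (X ^~ w) (k + t) in
  P (Y @^-1` A `&` X (k + t)%N @^-1` B) =
  (P (Y @^-1` A) * P (X (k + t)%N @^-1` B))%E.
Proof.
move=> mA mB Y.
have hs : (1 <= k + t <= n)%N by rewrite ktn addn_gt0 t_gt0 orbT.
apply: (independent_of_others mX indX hs) => //.
pose G := other_rectangles n X (k + t).
(* [Omega] is given the sigma-algebra generated by the components other than [k + t]. The level uses
   only the demands [i + t] with [i < k], all measurable there. *)
have mY : measurable_fun [set: g_sigma_algebraType G] Y.
  apply: (@measurable_level R pi t x _ (g_sigma_algebraType G) (cst u) X).
    exact: measurable_cst.
  move=> i ik _ C mC; rewrite setTI; apply: measurable_other_component => //.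
    rewrite addn_gt0 t_gt0 orbT/= (leq_trans _ ktn)// leq_add2r; exact: ltnW.
  by rewrite eqn_add2r neq_ltn ik.
by have := mY measurableT _ mA; rewrite setTI.
Qed.

Let mlevel : measurable_fun setT
  (fun w : Omega * seed pi => level t x w.2 (X ^~ w.1) (k + t)).
Proof.
apply: (@measurable_level R pi t x _ _ snd (fun s w => X s w.1)) => // i _.
exact: measurableT_comp.
Qed.

Let mlevelu (u : seed pi) : measurable_fun setT
  (fun w : Omega => level t x u (X ^~ w) (k + t)).
Proof. exact: (@measurable_level R pi t x _ _ (cst u) X). Qed.

Lemma measurable_averaged :
  measurable_fun setT (fun y => \int[P]_w f (y, X (k + t)%N w))%E.
Proof.
apply: (measurable_fun_fubini_tonelli_F (fun z => f (z.1, X (k + t)%N z.2))).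
  apply: (measurableT_comp mf (f := f)
    (g := fun z : R * Omega => (z.1, X (k + t)%N z.2))).
  by apply: measurable_fun_pair => //; exact: measurableT_comp.
by move=> z; exact: f0.
Qed.

(** The outcome [w'] acts as a fresh copy of the current demand. Tonelli freezes the seed first,
    after which independence of level and demand under [P] alone suffices. *)
Lemma integral_level_demand :
  (\int[P \x seed_law pi]_w
      f (level t x w.2 (X ^~ w.1) (k + t), X (k + t)%N w.1) =
   \int[P \x seed_law pi]_w
      \int[P]_w' f (level t x w.2 (X ^~ w.1) (k + t), X (k + t)%N w'))%E.
Proof.
rewrite fubini_tonelli2; last 2 first.
- apply: (measurableT_comp mf (f := f) (g := fun w : Omega * seed pi =>
    (level t x w.2 (X ^~ w.1) (k + t), X (k + t)%N w.1))).
  by apply: measurable_fun_pair => //; exact: measurableT_comp.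
- by move=> ?; exact: f0.
rewrite fubini_tonelli2; last 2 first.
- exact: (measurableT_comp measurable_averaged mlevel).
- by move=> ?; apply: integral_ge0 => *; exact: f0.
apply: eq_integral => u _; rewrite /fubini_G /=.
apply: (integral_independent_pair (mlevelu u)) => //.
by move=> A B mA mB; exact: level_independent.
Qed.

End PeriodStep.

(** * Convex Lipschitz value functions *)

Lemma lipschitz_continuous_real (R : realType) (f : R -> R) (L : R) :
  (forall x y, `|f x - f y| <= L * `|x - y|) -> continuous f.
Proof.
move=> fL x; apply/cvgrPdist_lt => e e0.
have L0 : 0 < `|L| + 1 by rewrite ltr_pwDr.
near=> y.
apply: (le_lt_trans (fL x y)).
apply: (@le_lt_trans _ _ ((`|L| + 1) * `|x - y|)).
  by rewrite ler_wpM2r// (le_trans (ler_norm L))// lerDl.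
rewrite mulrC -ltr_pdivlMr//.
near: y; apply: (@cvgr_dist_lt _ _ _ _ _ id x) => //.
exact: divr_gt0.
Unshelve. all: by end_near. Qed.

(** The class preserved by the Bellman recursion. Nonnegativity serves Tonelli, the Lipschitz bound
    gives continuity and measurability, and monotonicity with convexity makes [v] composed with
    [pos_part] convex. *)
Record value_like (R : realType) (v : R -> R) : Prop := ValueLike {
  value_ge0 : forall x, 0 <= v x;
  value_homo : {homo v : x y / x <= y};
  value_lipschitz : exists L, forall x y, `|v x - v y| <= L * `|x - y|;
  value_convex : forall r x y, 0 <= r <= 1 ->
    v (r * x + (1 - r) * y) <= r * v x + (1 - r) * v y
}.

Lemma value_like0 (R : realType) : value_like (fun _ : R => 0).
Proof.
split => //; first by exists 0 => x y; rewrite subrr normr0 mul0r.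
by move=> r x y _; rewrite !mulr0 addr0.
Qed.

Lemma measurable_value_like (R : realType) (v : R -> R) :
  value_like v -> measurable_fun setT v.
Proof.
move=> [_ _ [L vL] _]; apply: continuous_measurable_fun.
exact: lipschitz_continuous_real vL.
Qed.

Section PosPart.
Variable R : realType.
Implicit Types x y u w e r : R.

Lemma pos_part_ge0 x : 0 <= pos_part x.
Proof. by rewrite /pos_part le_max lexx orbT. Qed.

Lemma pos_part_homo : {homo @pos_part R : x y / x <= y}.
Proof. by move=> x y xy; rewrite /pos_part ge_max !le_max xy lexx orbT. Qed.

Lemma maxr_lipschitz x y u : `|Num.max x u - Num.max y u| <= `|x - y|.
Proof.
rewrite /Num.max; case: ltP => xu; case: ltP => yu; rewrite ?subrr ?normr0//.
- by rewrite !ler0_norm; lra.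
- by rewrite !ger0_norm; lra.
Qed.

Lemma pos_part_lipschitz x y : `|pos_part x - pos_part y| <= `|x - y|.
Proof. exact: maxr_lipschitz. Qed.

Lemma pos_part_convex r x y : 0 <= r <= 1 ->
  pos_part (r * x + (1 - r) * y) <= r * pos_part x + (1 - r) * pos_part y.
Proof.
move=> r01; rewrite {1}/pos_part ge_max; apply/andP; split.
  have : x <= pos_part x by rewrite /pos_part le_max lexx.
  have : y <= pos_part y by rewrite /pos_part le_max lexx.
  nra.
have := pos_part_ge0 x; have := pos_part_ge0 y; nra.
Qed.

End PosPart.

(** * One-period cost plus the value of the next state *)

Section CostToGo.
Context {R : realType} (M : lost_sales_model R) (s : nat).
Hypothesis hs : period M s.
Variable v : R -> R.
Hypothesis hv : value_like v.

Definition cost_to_go (y e : R) : R :=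
  period_cost M s y e + v (pos_part (y - e)).

Let h0 : 0 < hold M s := hold_gt0 hs.
Let p0 : 0 < short M s := short_gt0 hs.

Lemma period_cost_ge0 y e : 0 <= period_cost M s y e.
Proof. by rewrite addr_ge0// mulr_ge0 ?pos_part_ge0 ?ltW. Qed.

Lemma cost_to_go_ge0 y e : 0 <= cost_to_go y e.
Proof. by rewrite addr_ge0 ?period_cost_ge0 ?(value_ge0 hv). Qed.

Lemma cost_to_go_convex e r x y : 0 <= r <= 1 ->
  cost_to_go (r * x + (1 - r) * y) e <=
  r * cost_to_go x e + (1 - r) * cost_to_go y e.
Proof.
move=> r01; rewrite /cost_to_go /period_cost.
have -> : r * x + (1 - r) * y - e = r * (x - e) + (1 - r) * (y - e) by ring.
have -> : e - (r * x + (1 - r) * y) = r * (e - x) + (1 - r) * (e - y) by ring.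
have c1 := pos_part_convex (x - e) (y - e) r01.
have c2 := pos_part_convex (e - x) (e - y) r01.
(* A nondecreasing convex function of a convex function is convex. *)
have c3 := le_trans (value_homo hv c1)
  (value_convex hv (pos_part (x - e)) (pos_part (y - e)) r01).
have c1' := ler_wpM2l (ltW h0) c1; have c2' := ler_wpM2l (ltW p0) c2.
lra.
Qed.

Lemma cost_to_go_lipschitz : exists L, forall x y e,
  `|cost_to_go x e - cost_to_go y e| <= L * `|x - y|.
Proof.
have [L vL] := value_lipschitz hv.
(* The constant in [value_lipschitz] carries no sign, hence [|L|]. The new constant does not depend
   on the demand [e], so it survives taking expectations. *)
exists (hold M s + short M s + `|L|) => x y e.
have -> : cost_to_go x e - cost_to_go y e =
    hold M s * (pos_part (x - e) - pos_part (y - e)) +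
    short M s * (pos_part (e - x) - pos_part (e - y)) +
    (v (pos_part (x - e)) - v (pos_part (y - e))).
  by rewrite /cost_to_go /period_cost; ring.
have l1 := pos_part_lipschitz (x - e) (y - e).
have l2 := pos_part_lipschitz (e - x) (e - y).
rewrite (_ : x - e - (y - e) = x - y) in l1; last ring.
rewrite (_ : e - x - (e - y) = y - x) in l2; last ring.
rewrite [X in _ <= X]distrC in l2.
rewrite !mulrDl; apply: (le_trans (ler_normD _ _)); apply: lerD.
  apply: (le_trans (ler_normD _ _)); rewrite !normrM (gtr0_norm h0) (gtr0_norm p0).
  by apply: lerD; rewrite ler_pM2l.
apply: (le_trans (vL _ _)); apply: (@le_trans _ _ (`|L| * `|pos_part (x - e) - pos_part (y - e)|)).
  by rewrite ler_wpM2r// ler_norm.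
by rewrite ler_wpM2l.
Qed.

(* Above [a] the one-period cost has slope [h] or at least [- p] according to
   whether the demand is below [a]. *)
Lemma cost_to_go_slope a y e : a <= y ->
  (y - a) * ((hold M s + short M s) * (e < a)%R%:R - short M s) <=
  cost_to_go y e - cost_to_go a e.
Proof.
move=> ay.
have vm : v (pos_part (a - e)) <= v (pos_part (y - e)).
  by apply: (value_homo hv); apply: pos_part_homo; rewrite lerD2r.
suff : (y - a) * ((hold M s + short M s) * (e < a)%R%:R - short M s) <=
    period_cost M s y e - period_cost M s a e by rewrite /cost_to_go; lra.
have pos_id (u : R) : 0 <= u -> pos_part u = u by move=> u0; rewrite /pos_part max_l.
have pos_0 (u : R) : u <= 0 -> pos_part u = 0 by move=> u0; rewrite /pos_part max_r.
rewrite /period_cost; case: ltP => [ea|ae] /=.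
  rewrite (pos_id (y - e)) ?(pos_id (a - e)) ?(pos_0 (e - y)) ?(pos_0 (e - a)); lra.
rewrite (pos_0 (a - e)) ?(pos_id (e - a)) ?subr_ge0 ?subr_le0//.
have [ey|ye] := ltP e y.
  rewrite (pos_id (y - e)) ?(pos_0 (e - y)) ?subr_ge0 ?subr_le0 ?(ltW ey)//.
  have : 0 <= (hold M s + short M s) * (y - e).
    by rewrite mulr_ge0 ?subr_ge0 ?ltW ?addr_gt0.
  lra.
by rewrite (pos_0 (y - e)) ?(pos_id (e - y)) ?subr_ge0 ?subr_le0//; lra.
Qed.

(** The bound is uniform in the demand, which yields integrability for any demand in [[0, B]]. *)
Lemma cost_to_go_bounded (B y e : R) : 0 <= e <= B -> `|cost_to_go y e| <=
  hold M s * pos_part y + short M s * pos_part (B - y) + v (pos_part y).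
Proof.
move=> /andP[e0 eB]; rewrite ger0_norm ?cost_to_go_ge0//.
have i1 : pos_part (y - e) <= pos_part y by apply: pos_part_homo; lra.
have i2 : pos_part (e - y) <= pos_part (B - y) by apply: pos_part_homo; lra.
apply: lerD; last exact: (value_homo hv).
by apply: lerD; rewrite ler_pM2l.
Qed.

Lemma measurable_cost_to_go d (T : measurableType d) (f g : T -> R) :
  measurable_fun setT f -> measurable_fun setT g ->
  measurable_fun setT (fun w => cost_to_go (f w) (g w)).
Proof.
move=> mf mg; apply: measurable_funD; first exact: measurable_period_cost.
apply: (measurableT_comp (measurable_value_like hv)).
by apply: measurable_pos_part; exact: measurable_funB.
Qed.

End CostToGo.

Lemma Rintegral_probability_cst (R : realType) d (T : measurableType d)
    (P : probability T R) (c : R) : \int[P]_w c = c.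
Proof.
rewrite Rintegral_cst// -[RHS]mulr1; congr (_ * _).
exact: (congr1 fine (probability_setT P)).
Qed.

(** * The Bellman recursion *)

Section BellmanStep.
Context {R : realType} (M : lost_sales_model R) (s : nat).
Hypothesis hs : period M s.
Variable v : R -> R.
Hypothesis hv : value_like v.
Context {d : measure_display} {Omega : measurableType d}.
Variables (P : probability Omega R) (X : Omega -> R) (B : R).
Hypothesis mX : measurable_fun setT X.
Hypothesis X_bounded : forall w, 0 <= X w <= B.

Definition expected_cost (y : R) : R := \int[P]_w cost_to_go M s v y (X w).

Lemma integrable_cost_to_go y :
  P.-integrable setT (EFin \o (fun w => cost_to_go M s v y (X w))).
Proof.
apply: measurable_bounded_integrable => //.
- by rewrite (le_lt_trans (probability_le1 _ _))// ltry.
- by apply: measurable_cost_to_go => //; exact: measurable_cst.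
- exists (hold M s * pos_part y + short M s * pos_part (B - y) + v (pos_part y)).
  split; first exact: num_real.
  move=> c cB w _; apply: (le_trans _ (ltW cB)).
  exact: cost_to_go_bounded.
Qed.

Lemma expected_cost_ge0 y : 0 <= expected_cost y.
Proof. by apply: Rintegral_ge0 => w _; exact: cost_to_go_ge0. Qed.

Lemma EFin_expected_cost y :
  (expected_cost y)%:E = (\int[P]_w (cost_to_go M s v y (X w))%:E)%E.
Proof.
rewrite /expected_cost /Rintegral fineK//.
by apply: integrable_fin_num => //; exact: integrable_cost_to_go.
Qed.

Lemma expected_cost_convex r x y : 0 <= r <= 1 ->
  expected_cost (r * x + (1 - r) * y) <=
  r * expected_cost x + (1 - r) * expected_cost y.
Proof.
move=> r01; rewrite /expected_cost.
have ix := integrable_cost_to_go x; have iy := integrable_cost_to_go y.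
have ix' := integrableZl measurableT r ix.
have iy' := integrableZl measurableT (1 - r) iy.
rewrite -RintegralZl// -RintegralZl// -RintegralD//.
apply: le_Rintegral => //; first exact: integrable_cost_to_go.
  exact: integrableD ix' iy'.
by move=> w _; exact: cost_to_go_convex.
Qed.

Lemma expected_cost_lipschitz : exists L, forall x y,
  `|expected_cost x - expected_cost y| <= L * `|x - y|.
Proof.
have [L cL] := cost_to_go_lipschitz hs hv; exists L => x y.
have ix := integrable_cost_to_go x; have iy := integrable_cost_to_go y.
have ixy := integrableB measurableT ix iy.
rewrite /expected_cost -RintegralB//.
apply: (le_trans (le_normr_Rintegral _ _)) => //.
have -> : L * `|x - y| = \int[P]_w (cst (L * `|x - y|) w).
  by rewrite Rintegral_probability_cst.
apply: le_Rintegral => //; first exact: (integrable_norm ixy).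
exact: finite_measure_integrable_cst.
Qed.

Variable a : R.
Hypothesis a0 : 0 <= a.
Hypothesis ratio : ((critical_ratio M s)%:E <= P [set w | (X w < a)%R])%E.

(** Integrating [cost_to_go_slope] bounds the difference below by
    [(y - a) * ((h + p) * P(X < a) - p)], which is nonnegative because [P(X < a) >= p / (h + p)]. *)
Lemma expected_cost_ge_cap y : a <= y -> expected_cost a <= expected_cost y.
Proof.
move=> ay.
have ix := integrable_cost_to_go a; have iy := integrable_cost_to_go y.
rewrite -subr_ge0 /expected_cost -RintegralB//.
have mA : measurable [set w | X w < a].
  rewrite (_ : [set w | X w < a] = X @^-1` `]-oo, a[%classic).
    by rewrite -[_ @^-1` _]setTI; exact: mX.
  by apply/seteqP; split => w /=; rewrite in_itv.
have i1 := integrable_indic P mA.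
pose g w := (y - a) * (hold M s + short M s) * \1_[set w | X w < a] w
  - (y - a) * short M s.
have ig1 := integrableZl measurableT ((y - a) * (hold M s + short M s)) i1.
have ig2 : P.-integrable setT (EFin \o cst ((y - a) * short M s)).
  exact: finite_measure_integrable_cst.
have ig : P.-integrable setT (EFin \o g).
  have := integrableB measurableT ig1 ig2.
  by apply: eq_integrable => // w _; rewrite /g /= EFinB EFinM.
apply: (@le_trans _ _ (\int[P]_w g w)); last first.
  have iyx := integrableB measurableT iy ix.
  apply: le_Rintegral => //.
  move=> w _; apply: le_trans (cost_to_go_slope hs hv (X w) ay).
  rewrite /g indicE; have -> : (w \in [set w | X w < a]) = (X w < a).
    by apply/idP/idP => [/set_mem|/mem_set].
  lra.
rewrite /g RintegralB//.
rewrite RintegralZl// Rintegral_probability_cst.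
rewrite /Rintegral integral_indic// setIT.
rewrite -mulrA -mulrBr mulr_ge0 ?subr_ge0//.
have h0 := hold_gt0 hs; have p0 := short_gt0 hs.
have : critical_ratio M s <= fine (P [set w | X w < a]).
  by rewrite -lee_fin fineK// fin_num_measure.
by rewrite /critical_ratio ler_pdivrMr ?addr_gt0// mulrC.
Qed.

(** [S] minimises over [[0, a]] by compactness, and over the half-line [y >= 0] by
    [expected_cost_ge_cap]. For [x >= 0] the value at [Num.max x S] is then the least expected cost
    over all levels [y >= x]. The same formula, constant to the left of [S], is monotone and convex
    on the whole line. *)
Lemma bellman_step : exists2 S, 0 <= S <= a &
  value_like (fun x => expected_cost (Num.max x S)) /\
  forall x y : R, 0 <= x <= y -> expected_cost (Num.max x S) <= expected_cost y.
Proof.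
have [L GL] := expected_cost_lipschitz.
have [S] : exists2 S, S \in `[0, a] & forall y, y \in `[0, a] ->
    expected_cost S <= expected_cost y.
  apply: EVT_min => //; apply: continuous_subspaceT.
  exact: lipschitz_continuous_real GL.
rewrite in_itv/= => /andP[S0 Sa] Smin.
have Sglob y : 0 <= y -> expected_cost S <= expected_cost y.
  move=> y0; have [ya|/ltW ay] := leP y a; first by apply: Smin; rewrite in_itv/= y0.
  by apply: le_trans (expected_cost_ge_cap ay); apply: Smin; rewrite in_itv/= lexx a0.
have Gmono x y : S <= x -> x <= y -> expected_cost x <= expected_cost y.
  move=> Sx xy.
  have [Sy|Sy] := eqVneq S y.
    by rewrite (_ : x = y)//; apply/eqP; rewrite eq_le xy -Sy Sx.
  have Sly : S < y by rewrite lt_neqAle Sy (le_trans Sx).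
  (* The weight that writes [x] as [r * S + (1 - r) * y]. Convexity and minimality of [S] then bound
     the cost at [x] by the cost at [y]. *)
  pose r := (y - x) / (y - S).
  have r01 : 0 <= r <= 1.
    by rewrite /r divr_ge0 ?subr_ge0 ?(ltW Sly)//= ler_pdivrMr ?subr_gt0// mul1r lerD2l lerN2.
  have -> : x = r * S + (1 - r) * y.
    by rewrite /r; field; rewrite subr_eq0 eq_sym.
  apply: (le_trans (expected_cost_convex _ _ r01)).
  have := Sglob y (ltW (le_lt_trans S0 Sly)); nra.
exists S; first by rewrite S0.
split; first split.
- by move=> x; exact: expected_cost_ge0.
- move=> x y xy; apply: Gmono; first by rewrite le_max lexx orbT.
  by rewrite ge_max !le_max xy lexx orbT.
- exists `|L| => x y; apply: (le_trans (GL _ _)).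
  apply: (@le_trans _ _ (`|L| * `|Num.max x S - Num.max y S|)).
    by rewrite ler_wpM2r// ler_norm.
  by rewrite ler_wpM2l// maxr_lipschitz.
(* [Num.max _ S] is convex with values in [[S, +oo[], where the expected cost is nondecreasing. *)
- move=> r x y r01; apply: le_trans (expected_cost_convex _ _ r01).
  apply: Gmono; first by rewrite le_max lexx orbT.
  have : x <= Num.max x S by rewrite le_max lexx.
  have : y <= Num.max y S by rewrite le_max lexx.
  have : S <= Num.max x S by rewrite le_max lexx orbT.
  have : S <= Num.max y S by rewrite le_max lexx orbT.
  rewrite ge_max => ? ? ? ?; apply/andP; split; nra.
- move=> x y /andP[x0 xy]; have [Sx|xS] := leP S x.
    exact: Gmono.
  by apply: Sglob; exact: le_trans xy.
Qed.

End BellmanStep.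

Lemma bellman_solution (R : realType) (M : lost_sales_model R)
    d (Omega : measurableType d) (P : probability Omega R)
    (X : nat -> Omega -> R) (B : R) (a : nat -> R) :
  (forall s, measurable_fun setT (X s)) ->
  (forall s, period M s -> forall w, 0 <= X s w <= B) ->
  (forall s, period M s -> 0 <= a s) ->
  (forall s, period M s ->
     ((critical_ratio M s)%:E <= P [set w | (X s w < a s)%R])%E) ->
  exists (S : nat -> R) (v : nat -> R -> R),
    [/\ v (horizon M).+1 = fun=> 0, (forall s, value_like (v s)) &
      forall s, period M s ->
        let G := expected_cost M s (v s.+1) P (X s) in
        [/\ 0 <= S s <= a s, (forall x, v s x = G (Num.max x (S s))) &
          forall x y : R, 0 <= x <= y -> v s x <= G y]].
Proof.
move=> mX bX a0 ratio.
(* Backward induction on the number [j] of final periods already solved. [S] and [v] are total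
   functions, and each round changes them at the single index [r = horizon M - j]. *)
suff main j : (j <= horizon M)%N -> exists (S : nat -> R) (v : nat -> R -> R),
    [/\ v (horizon M).+1 = fun=> 0, (forall s, value_like (v s)) &
      forall s, (horizon M - j < s <= horizon M)%N ->
        let G := expected_cost M s (v s.+1) P (X s) in
        [/\ 0 <= S s <= a s, (forall x, v s x = G (Num.max x (S s))) &
          forall x y : R, 0 <= x <= y -> v s x <= G y]].
  have [S [v [vT vl H]]] := main _ (leqnn _).
  by exists S, v; split => // s hs; apply: H; rewrite subnn.
elim: j => [_|j IH jT].
  exists (fun=> 0), (fun _ _ => 0); split => //.
    by move=> s; exact: value_like0.
  by move=> s; rewrite subn0 => /andP[h1 h2]; have := leq_trans h1 h2; rewrite ltnn.
have [S [v [vT vl H]]] := IH (ltnW jT).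
pose r := (horizon M - j)%N.
have hr : period M r by rewrite /period subn_gt0 jT leq_subr.
have [Sr Sr0 [vr vrle]] := bellman_step hr (vl r.+1) (mX r) (bX r hr) (a0 r hr) (ratio r hr).
exists (fun s => if s == r then Sr else S s).
exists (fun s => if s == r then
  fun x => expected_cost M r (v r.+1) P (X r) (Num.max x Sr) else v s).
split.
- by rewrite gtn_eqF// ltnS leq_subr.
- by move=> s; case: eqP.
move=> s /andP[rs sT].
(* The change at [r] touches neither [v r.+1] nor, for [s > r], any of [S s], [v s] and [v s.+1]. *)
have [->|sr] := eqVneq s r; first by rewrite gtn_eqF.
have rs' : (r < s)%N by rewrite ltn_neqAle eq_sym sr /r -subnSK.
rewrite (gtn_eqF (leqW rs')).
by apply: H; rewrite rs' sT.
Qed.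

(** * Verification: comparing arbitrary policies with the Bellman solution *)

Section Verification.
Context {R : realType} (M : lost_sales_model R).
Context {d : measure_display} {Omega : measurableType d}.
Variables (P : probability Omega R) (X : nat -> Omega -> R) (B : R).
Hypothesis mX : forall s, measurable_fun setT (X s).
Hypothesis indX : independent_upto P (horizon M) X.
Hypothesis bX : forall s, period M s -> forall w, 0 <= X s w <= B.
Variables (S : nat -> R) (v : nat -> R -> R).
Hypothesis vT : v (horizon M).+1 = fun=> 0.
Hypothesis vl : forall s, value_like (v s).
Hypothesis vE : forall s, period M s -> forall x,
  v s x = expected_cost M s (v s.+1) P (X s) (Num.max x (S s)).
Hypothesis v_le : forall s, period M s -> forall x y : R, 0 <= x <= y ->
  v s x <= expected_cost M s (v s.+1) P (X s) y.
Variables (t : nat) (x : R).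
Hypotheses (t_gt0 : (0 < t)%N) (x0 : 0 <= x).

Lemma inventory_ge0 (pi : policy R) (u : seed pi) (dem : nat -> R) k :
  0 <= (run t x u dem k).1.
Proof. by case: k => [//|k]; rewrite runS pos_part_ge0. Qed.

(** Cost incurred so far plus the optimal cost from the state reached. Its mean starts at [v t x]
    for [k = 0] and is the policy value at [k = (horizon M).+1 - t], where [v] vanishes. In between
    it never decreases, since a level is at least the inventory ([v_le]), and it stays constant for
    the base-stock rule ([vE]). *)
Definition provisional_cost (pi : policy R) k (w : Omega * seed pi) : R :=
  cost_upto M t x w.2 (X ^~ w.1) k + v (k + t) (run t x w.2 (X ^~ w.1) k).1.

Section Policy.
Variable pi : policy R.
Local Notation mu := (P \x seed_law pi)%E.
Let lvl k (w : Omega * seed pi) := level t x w.2 (X ^~ w.1) (k + t).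
Let cost k (w : Omega * seed pi) := cost_upto M t x w.2 (X ^~ w.1) k.

Let mX1 i : measurable_fun setT (fun w : Omega * seed pi => X i w.1).
Proof. exact: measurableT_comp. Qed.

Let mlvl k : measurable_fun setT (lvl k).
Proof. exact: (@measurable_level R pi t x _ _ snd (fun s w => X s w.1)). Qed.

Let mcost k : measurable_fun setT (cost k).
Proof. exact: (@measurable_cost_upto R pi t x _ _ snd (fun s w => X s w.1)). Qed.

Let minv k : measurable_fun setT
  (fun w : Omega * seed pi => (run t x w.2 (X ^~ w.1) k).1).
Proof. by have [] := @measurable_run R pi t x _ _ snd (fun s w => X s w.1) _ k. Qed.

Let cost_ge0 k w : (k + t <= (horizon M).+1)%N -> 0 <= cost k w.
Proof.
move=> kT; rewrite /cost /cost_upto big_nat_cond; apply: sumr_ge0 => i.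
rewrite andbT => /andP[_ ik]; apply: period_cost_ge0.
rewrite /period addn_gt0 t_gt0 orbT/= -ltnS (leq_trans _ kT)//.
by rewrite -addSn leq_add2r.
Qed.

Lemma integral_provisional_costS k : (k + t <= horizon M)%N ->
  (\int[mu]_w (provisional_cost k.+1 w)%:E =
   \int[mu]_w (cost k w)%:E +
   \int[mu]_w (expected_cost M (k + t) (v (k + t).+1) P (X (k + t)%N) (lvl k w))%:E)%E.
Proof.
move=> kT.
have hs : period M (k + t) by rewrite /period addn_gt0 t_gt0 orbT.
pose f (z : R * R) := (cost_to_go M (k + t) (v (k + t).+1) z.1 z.2)%:E.
have mf : measurable_fun [set: R * R] f.
  by apply/measurable_EFinP; exact: measurable_cost_to_go.
have f0 z : (0 <= f z)%E by rewrite lee_fin cost_to_go_ge0.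
(* The cost of period [k + t] and the value of the state it leaves combine into [cost_to_go], a
   function of level and demand alone. *)
transitivity (\int[mu]_w ((cost k w)%:E + f (lvl k w, X (k + t)%N w.1)))%E.
  apply: eq_integral => w _; rewrite -EFinD /provisional_cost /cost_upto.
  rewrite big_nat_recr// runS /f /cost_to_go /lvl -addrA.
  by rewrite !level_run addSn.
rewrite ge0_integralD//; last 3 first.
- by move=> w _; rewrite lee_fin cost_ge0// ltnW.
- exact/measurable_EFinP.
- apply: (measurableT_comp mf (f := f) (g := fun w => (lvl k w, X (k + t)%N w.1))).
  exact: measurable_fun_pair.
congr (_ + _)%E; rewrite (integral_level_demand mX indX pi x t_gt0 kT mf f0).
by apply: eq_integral => w _; rewrite (EFin_expected_cost hs (vl _) P (mX _) (bX hs)).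
Qed.

Lemma integral_provisional_cost k : (k + t <= horizon M)%N ->
  (\int[mu]_w (provisional_cost k w)%:E =
   \int[mu]_w (cost k w)%:E +
   \int[mu]_w (v (k + t) (run t x w.2 (X ^~ w.1) k).1)%:E)%E.
Proof.
move=> kT; rewrite -ge0_integralD//.
- by move=> w _; rewrite lee_fin cost_ge0// ltnW.
- exact/measurable_EFinP.
- by move=> w _; rewrite lee_fin value_ge0.
- apply/measurable_EFinP.
  exact: (measurableT_comp (measurable_value_like (vl (k + t)))).
Qed.

Lemma provisional_cost_le k : (k + t <= horizon M)%N ->
  (\int[mu]_w (provisional_cost k w)%:E <= \int[mu]_w (provisional_cost k.+1 w)%:E)%E.
Proof.
move=> kT; rewrite integral_provisional_costS// integral_provisional_cost//.
have hs : period M (k + t) by rewrite /period addn_gt0 t_gt0 orbT.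
have [L GL] := expected_cost_lipschitz hs (vl (k + t).+1) P (mX (k + t)%N) (bX hs).
apply: leeD; first exact: lexx.
apply: ge0_le_integral => //.
- by move=> w _; rewrite lee_fin value_ge0.
- apply/measurable_EFinP.
  exact: (measurableT_comp (measurable_value_like (vl (k + t)))).
- apply/measurable_EFinP; apply: (measurableT_comp _ (mlvl k)).
  by apply: continuous_measurable_fun; exact: lipschitz_continuous_real GL.
- move=> w _; rewrite lee_fin; apply: v_le => //.
  by rewrite inventory_ge0//= /lvl level_run act_ge// inventory_ge0.
Qed.

Lemma provisional_cost_eq k : (k + t <= horizon M)%N ->
  (forall s j (u : seed pi) y (z : j.-tuple R), act s u y z = Num.max y (S s)) ->
  (\int[mu]_w (provisional_cost k w)%:E = \int[mu]_w (provisional_cost k.+1 w)%:E)%E.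
Proof.
move=> kT actE; rewrite integral_provisional_costS// integral_provisional_cost//.
have hs : period M (k + t) by rewrite /period addn_gt0 t_gt0 orbT.
congr (_ + _)%E; apply: eq_integral => w _.
by rewrite vE// /lvl level_run actE.
Qed.

Lemma provisional_cost0 : (\int[mu]_w (provisional_cost 0 w)%:E = (v t x)%:E)%E.
Proof.
rewrite /provisional_cost (eq_integral (cst (v t x)%:E)).
  rewrite integral_cst// -[RHS]mule1; congr (_ * _)%E.
  transitivity (P setT * seed_law pi setT)%E.
    by rewrite -setXTT; exact: product_measure1E.
  by rewrite !probability_setT mule1.
by move=> w _; rewrite /cost_upto big_geq// add0r add0n.
Qed.

Lemma policy_value_provisional : (t <= (horizon M).+1)%N ->
  policy_value M P X t x pi =
  (\int[mu]_w (provisional_cost ((horizon M).+1 - t) w)%:E)%E.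
Proof.
move=> tT; apply: eq_integral => w _.
by rewrite total_cost_upto /provisional_cost subnK// vT addr0.
Qed.

Lemma policy_value_ge : (t <= (horizon M).+1)%N ->
  ((v t x)%:E <= policy_value M P X t x pi)%E.
Proof.
move=> tT; rewrite policy_value_provisional// -provisional_cost0.
have : (((horizon M).+1 - t) + t <= (horizon M).+1)%N by rewrite subnK.
elim: (_ - t)%N => [//|k IH kT].
apply: (le_trans (IH (ltnW kT))).
exact: provisional_cost_le.
Qed.

Lemma policy_value_base_stock : (t <= (horizon M).+1)%N ->
  (forall s j (u : seed pi) y (z : j.-tuple R), act s u y z = Num.max y (S s)) ->
  policy_value M P X t x pi = (v t x)%:E.
Proof.
move=> tT actE; rewrite policy_value_provisional// -provisional_cost0.
have : (((horizon M).+1 - t) + t <= (horizon M).+1)%N by rewrite subnK.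
elim: (_ - t)%N => [//|k IH kT].
by rewrite -provisional_cost_eq// IH// ltnW.
Qed.

End Policy.
End Verification.

(** * Carry-safe caps *)

Section CarrySafe.
Context {R : realType} (M : lost_sales_model R) (lambda : nat -> R).
Local Notation a := (carry_safe M lambda).

Lemma carry_safe_le t s : (t <= s <= horizon M)%N -> a t <= lambda s.
Proof.
move=> ts; apply: ge_bigmin_seq => //.
by rewrite mem_index_iota ltnS.
Qed.

Lemma le_carry_safe t y : (t <= horizon M)%N ->
  (forall s, (t <= s <= horizon M)%N -> y <= lambda s) -> y <= a t.
Proof.
move=> tT H; rewrite /carry_safe big_nat_cond; apply: le_bigmin.
  by apply: H; rewrite leqnn.
by move=> s; rewrite andbT ltnS => ?; exact: H.
Qed.

Lemma carry_safe_homo t s : (t <= s <= horizon M)%N -> a t <= a s.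
Proof.
move=> /andP[ts sT]; apply: le_carry_safe => // i /andP[si iT].
by apply: carry_safe_le; rewrite (leq_trans ts).
Qed.

End CarrySafe.

(** * Pathwise coupling of the original and truncated systems *)

Section Coupling.
Context {R : realType} (M : lost_sales_model R) (a : nat -> R).
Variables (pi : policy R) (t : nat) (x : R) (u : seed pi) (dem : nat -> R).

Lemma eq_run (dem' : nat -> R) k :
  (forall i, (i < k)%N -> dem (i + t)%N = dem' (i + t)%N) ->
  run t x u dem k = run t x u dem' k.
Proof.
elim: k => [//|k IH] H.
by rewrite !runS H// IH// => i ik; apply: H; rewrite leqW.
Qed.

Lemma eq_total_cost (dem' : nat -> R) :
  (forall s, (t <= s <= horizon M)%N -> dem s = dem' s) ->
  total_cost t x u dem M = total_cost t x u dem' M.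
Proof.
move=> H; apply: eq_big_nat => s; rewrite ltnS => /andP[ts sT].
rewrite H ?ts// /level (eq_run (dem' := dem'))// => i ist.
apply: H; rewrite leq_addl/=; apply: leq_trans sT; rewrite -[leqRHS](subnK ts).
by rewrite leq_add2r ltnW.
Qed.

Hypothesis within : levels_within t x u dem M a.
Let dem' s := Num.min (dem s) (a s).

(** Truncation alters a demand only above the cap, hence above the level; then either demand sells
    the whole level and leaves no stock. The range includes the state left after the last period. *)
Lemma run_truncate k : (k + t <= (horizon M).+1)%N ->
  run t x u dem k = run t x u dem' k.
Proof.
elim: k => [//|k IH] kT.
have : level t x u dem (k + t) <= a (k + t)%N.
  by apply: within; rewrite leq_addl.
have eqk := IH (ltnW kT).
rewrite level_run (runS t x u dem) (runS t x u dem') -eqk; move: (act _ _ _ _) => y ya.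
congr pair; last by rewrite /dem' -minA (min_idPr ya).
rewrite /dem' /pos_part; have [//|ad] := leP (dem (k + t)%N) (a (k + t)%N).
by rewrite !max_r// subr_le0 // (le_trans ya)// ltW.
Qed.

Lemma level_truncate s : (t <= s <= horizon M)%N ->
  level t x u dem s = level t x u dem' s.
Proof.
move=> /andP[ts sT]; rewrite /level run_truncate// subnK//; exact: leqW.
Qed.

Lemma sales_truncate s : (t <= s <= horizon M)%N ->
  sales t x u dem s = sales t x u dem' s.
Proof.
move=> ts; rewrite /sales -level_truncate// /dem' -minA.
by rewrite (min_idPr (within ts)).
Qed.

Lemma inventory_truncate s : (t <= s <= (horizon M).+1)%N ->
  inventory t x u dem s = inventory t x u dem' s.
Proof.
by move=> /andP[ts sT]; rewrite /inventory run_truncate// subnK.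
Qed.

(** If [e > b], both [e] and [b] are at least [y], so only shortage is charged, and it is linear in
    the demand there. *)
Lemma period_cost_truncate s y e b : y <= b ->
  period_cost M s y e =
  period_cost M s y (Num.min e b) + short M s * (e - Num.min e b).
Proof.
move=> yb; rewrite /period_cost; have [eb|be] := leP e b.
  by rewrite subrr mulr0 addr0.
rewrite /pos_part (max_r (_ : y - e <= 0)) ?(max_r (_ : y - b <= 0)); try lra.
rewrite (max_l (_ : 0 <= e - y)) ?(max_l (_ : 0 <= b - y)); lra.
Qed.

Lemma total_cost_truncate :
  total_cost t x u dem M = total_cost t x u dem' M +
    \sum_(t <= s < (horizon M).+1) short M s * (dem s - dem' s).
Proof.
rewrite /total_cost -big_split; apply: eq_big_nat => s; rewrite ltnS => ts.
rewrite /= -level_truncate//.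
exact: period_cost_truncate (within ts).
Qed.

End Coupling.

(** * Base-stock policies *)

Section BaseStock.
Context {R : realType} (pi : policy R) (S : nat -> R).

Let order_up_to s k (u : seed pi) (y : R) (z : k.-tuple R) := Num.max y (S s).

Let measurable_order_up_to s k : measurable_fun [set: seed pi * R * k.-tuple R]
  (fun w => order_up_to s w.1.1 w.1.2 w.2).
Proof.
apply: measurable_maxr; last exact: measurable_cst.
by apply: (@measurableT_comp _ _ _ _ _ _ snd _ fst).
Qed.

Let order_up_to_ge s k (u : seed pi) (y : R) (z : k.-tuple R) :
  0 <= y -> y <= order_up_to s u y z.
Proof. by move=> _; rewrite le_max lexx. Qed.

(** A policy must come with a seed space; that of [pi] is borrowed and the actions ignore the
    seed. *)
Definition base_stock : policy R :=
  @Policy R _ _ (seed_law pi) order_up_to measurable_order_up_to order_up_to_ge.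

Lemma base_stock_within (M : lost_sales_model R) (lambda : nat -> R) t x
    (u : seed base_stock) (dem : nat -> R) :
  let a := carry_safe M lambda in
  (forall s, (t <= s <= horizon M)%N -> [/\ 0 <= a s, S s <= a s & 0 <= dem s]) ->
  x <= a t -> levels_within t x u dem M a.
Proof.
move=> a H xa s /andP[ts sT].
(* Invariant: the opening inventory respects the cap of its period. Nonnegative demand leaves at
   most the previous level, and the caps are nondecreasing in time. *)
have inv k : (k + t <= horizon M)%N -> (run t x u dem k).1 <= a (k + t)%N.
  elim: k => [//|k IH] kT; rewrite runS.
  have kt : (t <= k + t <= horizon M)%N by rewrite leq_addl ltnW.
  have [a0 Sa d0] := H _ kt; have ik := IH (ltnW kT).
  apply: (@le_trans _ _ (a (k + t)%N)); last first.
    by apply: carry_safe_homo; rewrite addSn leqnSn.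
  rewrite ge_max a0 andbT lerBlDr (@le_trans _ _ (a (k + t)%N))//.
    by rewrite ge_max ik.
  by rewrite lerDl.
have [_ Sa _] := H s (introT andP (conj ts sT)).
rewrite /level ge_max Sa andbT.
by have := inv (s - t)%N; rewrite subnK//; exact.
Qed.

End BaseStock.

(** * Policy values under almost sure changes and under truncation *)

Section Values.
Context {R : realType} (M : lost_sales_model R).
Context {d : measure_display} {Omega : measurableType d}.
Variable P : probability Omega R.
Implicit Types X Y : nat -> Omega -> R.
Variables (t : nat) (x : R).
Hypothesis t_gt0 : (0 < t)%N.

Lemma ae_product1 d' (T : measurableType d') (Q : probability T R)
    (A : Omega -> Prop) :
  {ae P, forall w, A w} -> {ae (P \x Q)%E, forall w, A w.1}.
Proof.
move=> [N [mN N0 AN]]; exists (N `*` setT); split.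
- exact: measurableX.
- transitivity (P N * Q setT)%E; first exact: product_measure1E.
  by rewrite N0 mul0e.
- by move=> [w q] /= H; split => //; apply: AN.
Qed.

Lemma measurable_total_cost X (pi : policy R) :
  (forall s, measurable_fun setT (X s)) ->
  measurable_fun setT
    (fun w : Omega * seed pi => (total_cost t x w.2 (X ^~ w.1) M)%:E).
Proof.
move=> mX; apply/measurable_EFinP.
under eq_fun do rewrite total_cost_upto.
apply: (@measurable_cost_upto R pi t x _ _ snd (fun s w => X s w.1)) => // i _.
exact: measurableT_comp.
Qed.

Lemma total_cost_ge0 (pi : policy R) (u : seed pi) (dem : nat -> R) :
  0 <= total_cost t x u dem M.
Proof.
rewrite /total_cost big_nat_cond; apply: sumr_ge0 => s.
rewrite andbT ltnS => /andP[ts sT]; apply: period_cost_ge0.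
by rewrite /period (leq_trans t_gt0).
Qed.

Lemma ae_policy_value X Y (pi : policy R) :
  (forall s, measurable_fun setT (X s)) -> (forall s, measurable_fun setT (Y s)) ->
  {ae P, forall w, forall s, period M s -> X s w = Y s w} ->
  policy_value M P X t x pi = policy_value M P Y t x pi.
Proof.
move=> mX mY XY; apply: ge0_ae_eq_integral => //.
- exact: measurable_total_cost.
- exact: measurable_total_cost.
- by move=> w _; rewrite lee_fin total_cost_ge0.
- by move=> w _; rewrite lee_fin total_cost_ge0.
apply: filterS (ae_product1 (seed_law pi) XY) => w H _; congr EFin.
apply: eq_total_cost => s /andP[ts sT].
by apply: H; rewrite /period sT (leq_trans t_gt0).
Qed.

Lemma ae_optimal_value X Y :
  (forall s, measurable_fun setT (X s)) -> (forall s, measurable_fun setT (Y s)) ->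
  {ae P, forall w, forall s, period M s -> X s w = Y s w} ->
  optimal_value M P X t x = optimal_value M P Y t x.
Proof.
move=> mX mY XY; congr ereal_inf.
apply/seteqP; split => _ [pi ->]; exists pi.
  exact: ae_policy_value.
by apply/esym; exact: ae_policy_value.
Qed.

Lemma measurable_truncate (a : nat -> R) X :
  (forall s, measurable_fun setT (X s)) ->
  forall s, measurable_fun setT (truncate a X s).
Proof.
by move=> mX s; apply: measurable_minr => //; exact: measurable_cst.
Qed.

(** The pathwise identity [total_cost_truncate] is integrated. All terms are nonnegative, so the
    equation holds in the extended reals without any integrability. *)
Lemma policy_value_truncate X (a : nat -> R) (pi : policy R) :
  (forall s, measurable_fun setT (X s)) ->
  stays_within M P X t x pi a ->
  policy_value M P X t x pi =
  (policy_value M P (truncate a X) t x pi + shortage_offset M P X (truncate a X) t)%E.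
Proof.
move=> mX within.
have mW := measurable_truncate a mX.
(* The value 0 outside [t..horizon M] makes [g s] nonnegative and measurable for every [s], as the
   lemmas on sums of integrals require. *)
pose g s w := (if (t <= s <= horizon M)%N then
  short M s * (X s w - truncate a X s w) else 0)%:E.
have mg s : measurable_fun setT (g s).
  apply/measurable_EFinP; case: (t <= s <= horizon M)%N; last exact: measurable_cst.
  apply: measurable_funM; first exact: measurable_cst.
  exact: measurable_funB.
have XW0 s w : 0 <= X s w - truncate a X s w by rewrite subr_ge0 ge_min lexx.
have p0 s : (t <= s <= horizon M)%N -> 0 < short M s.
  by move=> /andP[ts sT]; apply: short_gt0; rewrite sT (leq_trans t_gt0).
have g0 s w : (0 <= g s w)%E.
  rewrite lee_fin; case: ifP => // ts; rewrite mulr_ge0// ltW//; exact: p0.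
pose loss w := (\sum_(t <= s < (horizon M).+1) g s w)%E.
have loss0 w : (0 <= loss w)%E by exact: sume_ge0.
have mloss : measurable_fun setT loss by exact: emeasurable_sum.
have offsetE : shortage_offset M P X (truncate a X) t = (\int[P]_w loss w)%E.
  rewrite ge0_integral_sum//; apply: eq_big_nat => s; rewrite ltnS => ts.
  rewrite /g ts expectation.unlock -ge0_integralZl_EFin//.
  - by move=> w _; rewrite lee_fin XW0.
  - by apply/measurable_EFinP; exact: measurable_funB.
  - by rewrite ltW// p0.
(* The loss does not involve the seed, whose law has mass 1, so it may be integrated over the
   product space. *)
have -> : shortage_offset M P X (truncate a X) t =
    (\int[P \x seed_law pi]_w loss w.1)%E.
  rewrite offsetE (fubini_tonelli1 (fun w : Omega * seed pi => loss w.1))//; last first.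
    exact: measurableT_comp.
  apply: eq_integral => w _; rewrite /fubini_F.
  transitivity (loss w * seed_law pi setT)%E; first by rewrite probability_setT mule1.
  by rewrite -integral_cst.
rewrite /policy_value -ge0_integralD//; last 3 first.
- by move=> w _; rewrite lee_fin total_cost_ge0.
- exact: measurable_total_cost.
- exact: measurableT_comp.
apply: ge0_ae_eq_integral => //.
- exact: measurable_total_cost.
- apply: emeasurable_funD; first exact: measurable_total_cost.
  exact: measurableT_comp.
- by move=> w _; rewrite lee_fin total_cost_ge0.
- by move=> w _; rewrite adde_ge0// lee_fin total_cost_ge0.
apply: filterS within => w within _.
rewrite (total_cost_truncate within) EFinD; congr (_ + _)%E.
rewrite -sumEFin; apply: eq_big_nat => s; rewrite ltnS => ts.
by rewrite /g ts.
Qed.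

End Values.

Lemma independent_upto_comp (R : realType) d (Omega : measurableType d)
    (P : probability Omega R) n (X : nat -> Omega -> R) (g : nat -> R -> R) :
  (forall s, measurable_fun setT (g s)) -> independent_upto P n X ->
  independent_upto P n (fun s w => g s (X s w)).
Proof.
move=> mg indX A mA.
have /= -> := indX (fun s => g s @^-1` A s); first by [].
by move=> s; rewrite -[_ @^-1` _]setTI; exact: mg.
Qed.

(** * An optimal policy within the caps *)

Section Optimal.
Context {R : realType} (M : lost_sales_model R).
Context {d : measure_display} {Omega : measurableType d}.
Variables (P : probability Omega R) (X : nat -> Omega -> R) (B : R).
Hypothesis mX : forall s, measurable_fun setT (X s).
Hypothesis indX : independent_upto P (horizon M) X.
Hypothesis bX : forall s, period M s -> forall w, 0 <= X s w <= B.
Variable lambda : nat -> R.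
Local Notation a := (carry_safe M lambda).
Hypothesis a_ge0 : forall s, period M s -> 0 <= a s.
Hypothesis ratio : forall s, period M s ->
  ((critical_ratio M s)%:E <= P [set w | (X s w < a s)%R])%E.
Variables (t : nat) (x : R).
Hypotheses (ht : period M t) (hx : 0 <= x <= a t).

(** The cap property is stated for every nonnegative demand path, not just for [X], so that a policy
    optimal in one system can be run in the other. The policy [pi] provides the seed space. *)
Lemma optimal_base_stock (pi : policy R) : exists pi0 : policy R,
  [/\ policy_value M P X t x pi0 = optimal_value M P X t x,
    optimal_value M P X t x \is a fin_num &
    forall (u : seed pi0) (dem : nat -> R),
      (forall s, period M s -> 0 <= dem s) -> levels_within t x u dem M a].
Proof.
have [S [v [vT vl H]]] := bellman_solution mX bX a_ge0 ratio.
have [x0 xa] := andP hx; have [t0 tT] := andP ht.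
have Sa s : period M s -> 0 <= S s <= a s by move=> /H[].
have vE s (hs : period M s) y :
    v s y = expected_cost M s (v s.+1) P (X s) (Num.max y (S s)).
  by have [] := H s hs.
have v_le s (hs : period M s) y z : 0 <= y <= z ->
    v s y <= expected_cost M s (v s.+1) P (X s) z.
  by have [_ _] := H s hs; exact.
pose pi0 := base_stock pi S.
have val0 : policy_value M P X t x pi0 = (v t x)%:E.
  by apply: (policy_value_base_stock mX indX bX vT vl vE) => //; exact: leqW.
have opt : optimal_value M P X t x = (v t x)%:E.
  apply/eqP; rewrite eq_le; apply/andP; split.
    by rewrite -val0; apply: ereal_inf_lbound; exists pi0.
  apply: le_ereal_inf_tmp => _ [pi' ->].
  by apply: (policy_value_ge mX indX bX vT vl v_le) => //; exact: leqW.
exists pi0; split; [by rewrite val0 opt|by rewrite opt|].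
move=> u dem dem0; apply: base_stock_within => // s /andP[ts sT].
have hs : period M s by rewrite /period sT (leq_trans t0).
by have /andP[_ ?] := Sa s hs; split; [exact: a_ge0| |exact: dem0].
Qed.

End Optimal.

(** * Reduction to surely bounded demands *)

Section Clamp.
Context {R : realType} (B : R).
Hypothesis B0 : 0 <= B.

(** [law_support] bounds the demands almost surely, while the verification argument wants bounds at
    every outcome. Projecting onto [[0, B]] changes demands on a null set only and preserves
    independence. *)
Definition clamp (e : R) : R := Num.max 0 (Num.min e B).

Lemma measurable_clamp : measurable_fun setT clamp.
Proof.
apply: measurable_maxr; first exact: measurable_cst.
by apply: measurable_minr => //; exact: measurable_cst.
Qed.

Lemma clamp_bounded e : 0 <= clamp e <= B.
Proof. by rewrite /clamp le_max lexx ge_max B0 ge_min lexx orbT. Qed.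

Lemma clamp_id e : 0 <= e <= B -> clamp e = e.
Proof. by move=> /andP[e0 eB]; rewrite /clamp (min_idPl eB) (max_idPr e0). Qed.

Lemma clamp_lt e b : 0 < b -> e < b -> clamp e < b.
Proof. by move=> b0 eb; rewrite /clamp gt_max b0 gt_min eb. Qed.

End Clamp.

(** * Transfer of values and regret between the two systems *)

Theorem proposition5 (R : realType) (M : lost_sales_model R)
    (d : measure_display) (Omega : measurableType d) (P : probability Omega R)
    (D : nat -> {RV P >-> R}) (hD : demand_process M D)
    (d' : measure_display) (Omega' : measurableType d')
    (Q : probability Omega' R) (L : sales_logs Q)
    (hL : noninformative_censoring M L)
    (lambda : nat -> Omega' -> R) (hlambda : admissible_caps M L lambda)
    (* the realised offline data, hence the realised caps *)
    (w' : Omega') (x1 : R) :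
  let a := carry_safe M (lambda ^~ w') in
  let W := truncate a D in
  0 <= x1 <= a 1%N ->
  (forall t, period M t -> ((critical_ratio M t)%:E < left_cdf M t (a t))%E) ->
  forall (t : nat) (x : R) (pi : policy R),
  period M t -> 0 <= x <= a t -> stays_within M P D t x pi a ->
  [/\ policy_value M P D t x pi =
        (policy_value M P W t x pi + shortage_offset M P D W t)%E,
      (policy_value M P D t x pi - optimal_value M P D t x)%E =
        (policy_value M P W t x pi - optimal_value M P W t x)%E
    & forall (w : Omega) (u : seed pi),
      levels_within t x u (D ^~ w) M a ->
      (forall s, (t <= s <= horizon M)%N ->
         sales t x u (D ^~ w) s = sales t x u (W ^~ w) s) /\
      (forall s, (t <= s <= (horizon M).+1)%N ->
         inventory t x u (D ^~ w) s = inventory t x u (W ^~ w) s)].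
Proof.
move=> a W _ ratio t x pi ht hx within.
have [t0 tT] := andP ht.
have mD s : measurable_fun setT (D s : Omega -> R) by [].
have mW := measurable_truncate a mD.
have B0 : 0 <= Dbar M := ltW (Dbar_gt0 M).
pose X s w := clamp (Dbar M) (D s w).
have mX s : measurable_fun setT (X s).
  exact: measurableT_comp (measurable_clamp _) (mD s).
have mV := measurable_truncate a mX.
have aeD s : period M s -> {ae P, forall w, 0 <= D s w <= Dbar M}.
  move=> hs; exists (~` (D s @^-1` `[0, Dbar M]%classic)).
  have mI : measurable (D s @^-1` `[0, Dbar M]%classic).
    by rewrite -[_ @^-1` _]setTI; exact: mD.
  split; first exact: measurableC.
    rewrite probability_setC// (demand_law hD)// law_support//.
    by rewrite subee.
  by move=> w /= /negP nw; apply/negP; rewrite in_itv.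
have aeX : {ae P, forall w, forall s, period M s -> D s w = X s w}.
  apply: ae_foralln => s.
  have [hs|nhs] := pselect (period M s).
    by apply: filterS (aeD s hs) => w Dw _; rewrite /X clamp_id.
  by apply: aeW => w /nhs.
have aeW' : {ae P, forall w, forall s, period M s -> W s w = truncate a X s w}.
  by apply: filterS aeX => w H s hs; rewrite /W /truncate H.
(* Demand has no mass below 0, so a cap [a s <= 0] would give [left_cdf] the value 0, which cannot
   exceed the nonnegative critical ratio. *)
have a_gt0 s : period M s -> 0 < a s.
  move=> hs; rewrite ltNge; apply/negP => a0.
  have := ratio s hs; rewrite ltNge => /negP; apply.
  rewrite (_ : left_cdf M s (a s) = 0)%E.
    have h0 := hold_gt0 hs; have p0 := short_gt0 hs.
    by rewrite lee_fin divr_ge0 ?ltW// addr_gt0.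
  apply/eqP; rewrite -measure_le0 /left_cdf.
  apply: (@le_trans _ _ (law M s (~` `[0, Dbar M]%classic))).
    apply: le_measure; rewrite ?inE//; first exact: measurableC.
    move=> e /=; rewrite !in_itv/= => ea /andP[e0 _].
    by have := le_lt_trans e0 (lt_le_trans ea a0); rewrite ltxx.
  by rewrite probability_setC// law_support// subee.
have indD : independent_upto P (horizon M) (fun s => D s : Omega -> R).
  exact: demand_independent hD.
have bX s w : 0 <= X s w <= Dbar M by exact: clamp_bounded.
have ratioX s : period M s ->
    ((critical_ratio M s)%:E <= P [set w | (X s w < a s)%R])%E.
  move=> hs; apply: (le_trans (ltW (ratio s hs))).
  rewrite /left_cdf -(demand_law hD hs)//.
  apply: le_measure; rewrite ?inE.
  - by rewrite -[_ @^-1` _]setTI; exact: mD.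
  - rewrite (_ : [set w | _] = X s @^-1` `]-oo, a s[%classic).
      by rewrite -[_ @^-1` _]setTI; exact: mX.
    by apply/seteqP; split => w /=; rewrite in_itv.
  - by move=> w /=; rewrite in_itv/= => Da; apply: clamp_lt => //; exact: a_gt0.
have indX : independent_upto P (horizon M) X.
  by apply: (independent_upto_comp (g := fun=> clamp (Dbar M))) indD => s;
    exact: measurable_clamp.
have indV : independent_upto P (horizon M) (truncate a X).
  apply: (independent_upto_comp (g := fun s e => Num.min e (a s))) indX => s.
  by apply: measurable_minr => //; exact: measurable_cst.
have bV s : period M s -> forall w, 0 <= truncate a X s w <= Dbar M.
  move=> hs w; have /andP[X0 XB] := bX s w.
  by rewrite /truncate le_min X0 ltW ?a_gt0//= ge_min XB.
(* [Num.min e b < b] is equivalent to [e < b]: truncating at the cap leaves the strict event intact,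
   so the ratio condition passes to the truncated system. *)
have ratioV s : period M s ->
    ((critical_ratio M s)%:E <= P [set w | (truncate a X s w < a s)%R])%E.
  move=> hs; rewrite (_ : [set w | _] = [set w | X s w < a s]); first exact: ratioX.
  by apply/seteqP; split => w /=; rewrite /truncate gt_min ltxx orbF.
have a_ge0 s : period M s -> 0 <= a s by move=> /a_gt0/ltW.
have [piD [valD finD capD]] :=
  optimal_base_stock mX indX (fun s _ => bX s) a_ge0 ratioX ht hx pi.
have [piW [valW finW capW]] :=
  optimal_base_stock mV indV bV a_ge0 ratioV ht hx pi.
have aeD0 : {ae P, forall w, forall s, period M s -> 0 <= D s w}.
  by apply: filterS aeX => w H s hs; rewrite H//; have /andP[] := bX s w.
have withinD : stays_within M P D t x piD a.
  by apply: filterS (ae_product1 (seed_law piD) aeD0) => w H; exact: capD.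
have withinW : stays_within M P D t x piW a.
  by apply: filterS (ae_product1 (seed_law piW) aeD0) => w H; exact: capW.
(* Back from the clamped demands to [D] and [W], which agree with them almost surely. *)
rewrite -(ae_optimal_value x t0 mD mX aeX)
  -(ae_policy_value x t0 piD mD mX aeX) in valD finD.
rewrite -(ae_optimal_value x t0 mW mV aeW')
  -(ae_policy_value x t0 piW mW mV aeW') in valW finW.
have shift (pi' : policy R) := @policy_value_truncate _ M _ _ P t x t0 D a pi' mD.
set kappa := shortage_offset M P D W t.
(* The finite optimal value under [D] is the sum of the value of [piD] under [W] and [kappa], so
   both summands are finite. *)
have finK : kappa \is a fin_num.
  by move: finD; rewrite -valD (shift piD)// fin_numD => /andP[].
(* Each optimal policy is tried in the other system: [piW] gives the upper bound and [piD] the lower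
   one, both shifted by the same [kappa]. *)
have optE : optimal_value M P D t x = (optimal_value M P W t x + kappa)%E.
  apply/eqP; rewrite eq_le; apply/andP; split.
    by rewrite -valW -(shift piW)//; apply: ereal_inf_lbound; exists piW.
  rewrite -valD (shift piD)//; apply: leeD; last exact: lexx.
  by apply: ereal_inf_lbound; exists piD.
split; first exact: shift.
  rewrite (shift pi)// -/W -/kappa optE fin_num_oppeD// addeACA subee// adde0//.
move=> w u hw; split => s hs.
  exact: (sales_truncate hw).
exact: (inventory_truncate hw).
Qed.
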